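(* The upper orientable twin domination number of the complete graph $K_8$ is $DOM^{*}(K_8)=4$.
   Context: Let $D=(V,A)$ be a digraph. A subset $S \subseteq V$ is a twin dominating set of $D$ if for every vertex $v \in V - S$ there exist vertices $u_1, u_2 \in S$ (possibly equal) such that $(v,u_1)$ and $(u_2,v)$ are arcs of $D$. The twin domination number $\gamma^{*}(D)$ is the minimum cardinality of a twin dominating set of $D$. For a graph $G$, the upper orientable twin domination number is $DOM^{*}(G)=\max\{\gamma^{*}(D) : D \text{ is an orientation of } G\}$. *)

(* Defs.v *)
From mathcomp Require Import all_boot.

Set Implicit Arguments.
Unset Strict Implicit.
Unset Printing Implicit Defensive.

Record sgraph (V : finType) := SGraph {
  adj :> rel V;
  adj_sym : symmetric adj;
  adj_irrefl : irreflexive adj }.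

Lemma complete_sym (V : finType) : symmetric (fun u v : V => u != v).
Proof. by move=> u v; rewrite eq_sym. Qed.

Lemma complete_irrefl (V : finType) : irreflexive (fun u v : V => u != v).
Proof. by move=> u; rewrite eqxx. Qed.

Definition complete_graph (n : nat) : sgraph 'I_n :=
  SGraph (@complete_sym 'I_n) (@complete_irrefl 'I_n).

(* A digraph with vertex type V is given by its set of arcs, so that the
   digraphs on V form a finite type. *)
Definition digraph (V : finType) := {set V * V}.

Definition twin_dominating (V : finType) (D : digraph V) (S : {set V}) : bool :=
  [forall v, (v \notin S) ==>
     [exists u1 in S, (v, u1) \in D] && [exists u2 in S, (u2, v) \in D]].

Lemma twin_dominating_setT (V : finType) (D : digraph V) :
  twin_dominating D [set: V].
Proof. by apply/forallP => v; rewrite inE. Qed.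

(* The minimum is attained, because of twin_dominating_setT. *)
Definition twin_domination_number (V : finType) (D : digraph V) : nat :=
  #|[arg min_(S < [set: V] | twin_dominating D S) #|S|]|.

(* Arcs join adjacent vertices only, and each edge carries exactly one of its
   two possible arcs. *)
Definition orientation (V : finType) (G : sgraph V) (D : digraph V) : bool :=
  [forall u, forall v,
     if G u v then ((u, v) \in D) (+) ((v, u) \in D) else (u, v) \notin D].

Lemma orientation_exists (V : finType) (G : sgraph V) :
  exists D : digraph V, orientation G D.
Proof.
exists [set p : V * V | G p.1 p.2 && (enum_rank p.1 < enum_rank p.2)].
apply/forallP => u; apply/forallP => v; rewrite !inE /=.
have [Guv|] := boolP (G u v) => //.
rewrite -(adj_sym G u v) Guv /=.
have [||/val_inj/enum_rank_inj uv] := ltngtP (enum_rank u) (enum_rank v) => //.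
by rewrite uv adj_irrefl in Guv.
Qed.

(* By orientation_exists, the maximum is over a nonempty set. *)
Definition upper_twin_domination (V : finType) (G : sgraph V) : nat :=
  \max_(D : digraph V | orientation G D) twin_domination_number D.

(* Main.v *)
Require Import Defs.
From mathcomp Require Import all_boot zify.

Set Implicit Arguments.
Unset Strict Implicit.
Unset Printing Implicit Defensive.

(** Upper bound: in a tournament on n > 0 vertices some vertex beats at least
    half of the others, so greedily k vertices dominate (and, reversing arcs,
    k vertices absorb) any tournament on at most 2(2^k - 1) vertices.  Given a
    vertex x, a set dominating its in-neighbourhood I, a set absorbing its
    out-neighbourhood O, and x itself form a twin dominating set.  On 8
    vertices this has at most 4 elements unless x has out-degree 3 or 4.  So
    let every out-degree be 3 or 4, and let x have out-degree 3.  If O has a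
    sink, take x, the sink and two vertices dominating I.  Otherwise O is a
    cyclic triangle, absorbed by any two of its vertices, and some a in I beats
    all others in I but at most one d; if some o in O beats d, take x, a, o and another
    vertex of O, and if none does, d beats a, x and all of O, so that d has
    out-degree at least 5.

    Lower bound: add a source to the quadratic residue tournament on Z/7, in
    which any two vertices have a common out-neighbour.  Three vertices all
    in Z/7 are dominated by the source; otherwise, the one or two of them in
    Z/7 and the source have a common out-neighbour. *)

(** * Greedy domination in tournaments *)

Section Tournament.

Variables (T : finType) (e : rel T).
Hypothesis e_irr : irreflexive e.
Hypothesis e_total : forall u v, u != v -> e u v || e v u.

(** Averaging: over [A], out-degrees and in-degrees have equal sums, and at each vertex they add up
    to at least [#|A| - 1]. *)
Lemma exists_beats_half (A : {set T}) : A != set0 ->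
  exists2 x, x \in A & #|A| <= (#|[set y in A | e x y]|).*2.+1.
Proof.
move=> A0; apply/exists_inP; apply: contraT; rewrite negb_exists_in.
move=> /forall_inP small.
pose out x := #|[set y in A | e x y]|; pose inn x := #|[set y in A | e y x]|.
have sumE : \sum_(x in A) out x = \sum_(x in A) inn x.
  have cardE (P : pred T) : #|[set y in A | P y]| = \sum_(y in A) P y.
    by rewrite -sum1dep_card big_mkcondr; apply: eq_bigr => y _; case: (P y).
  rewrite /out /inn (eq_bigr _ (fun x _ => cardE (e x))).
  by rewrite (eq_bigr _ (fun x _ => cardE (e^~ x))) exchange_big.
have deg_ge x : x \in A -> #|A| <= (out x + inn x).+1.
  move=> xA; rewrite (cardsD1 x A) xA ltnS.
  apply: leq_trans (leq_card_setU _ _); apply/subset_leq_card/subsetP => y.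
  rewrite !inE eq_sym => /andP[/e_total exy ->].
  by case/orP: exy => ->; rewrite ?orbT.
have : \sum_(x in A) #|A| <= \sum_(x in A) (out x + inn x).+1 by apply: leq_sum.
have : \sum_(x in A) (out x).*2.+2 <= \sum_(x in A) #|A|.
  by apply: leq_sum => x /small; rewrite -ltnNge.
have -> : \sum_(x in A) (out x + inn x).+1 = \sum_(x in A) (out x).*2.+1.
  rewrite -!(eq_bigr _ (fun x _ => addn1 _)) !big_split /= -sumE.
  by rewrite -(eq_bigr _ (fun x _ => addnn (out x))) big_split.
rewrite -(eq_bigr _ (fun x _ => addn1 (out x).*2.+1)) big_split /= sum1_card.
by move: A0; rewrite -card_gt0; lia.
Qed.

Lemma cards_beats (A : {set T}) x : x \in A ->
  #|A| = (#|[set y in A | e x y]| + #|[set y in A | (y != x) && ~~ e x y]|).+1.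
Proof.
move=> xA; rewrite (cardsD1 x A) xA; congr _.+1.
rewrite -(cardsID [set y | e x y]); congr (_ + _); apply: eq_card => y.
  by rewrite !inE; case: eqVneq => [->|_]; rewrite ?e_irr ?andbF.
by rewrite !inE; case: (y == x); case: (y \in A); case: (e x y).
Qed.

Lemma exists_dominating k (A : {set T}) : #|A|.+2 <= 2 ^ k.+1 ->
  exists P : {set T}, [/\ P \subset A, #|P| <= k &
    forall v, v \in A -> v \notin P -> exists2 u, u \in P & e u v].
Proof.
elim: k A => [|k IHk] A leA.
  have /eqP : #|A| == 0 by rewrite -leqn0 -2!ltnS.
  move/cards0_eq => ->.
  by exists set0; rewrite sub0set cards0; split=> // v; rewrite inE.
have [->|A0] := eqVneq A set0.
  by exists set0; rewrite cards0 sub0set; split=> // v; rewrite inE.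
have [x xA xhalf] := exists_beats_half A0.
have cardA := cards_beats xA.
set B := [set y in A | (y != x) && ~~ e x y] in cardA.
(* By [xhalf] and [cardA], [2 * #|B| + 1 <= #|A|], so [2 * #|B| + 4 <= 2 ^ k.+2 + 1]; parity removes
   the 1. *)
have /IHk[P [PB leP domP]] : #|B|.+2 <= 2 ^ k.+1.
  by move: leA; rewrite expnS; lia.
exists (x |: P); split.
- rewrite subUset sub1set xA; apply: subset_trans PB _.
  by apply/subsetP => y; rewrite inE => /andP[].
- by rewrite cardsU1; case: (x \notin P) => //=; lia.
- move=> v vA; rewrite !inE negb_or => /andP[vx vP].
  have [exv|nexv] := boolP (e x v); first by exists x; rewrite // setU11.
  have [|u uP euv] := domP v _ vP; first by rewrite inE vA vx.
  by exists u; rewrite // setU1r.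
Qed.

End Tournament.

(** * Twin domination in tournaments on eight vertices *)

Section TwinDominatingTournament.

Variables (T : finType) (e : rel T).
Hypothesis e_asym : forall u v, e u v -> ~~ e v u.
Hypothesis e_total : forall u v, u != v -> e u v || e v u.

Let e_irr : irreflexive e.
Proof. by move=> u; apply/negP => euu; have := e_asym euu; rewrite euu. Qed.

Let r : rel T := fun u v => e v u.

Let r_irr : irreflexive r. Proof. exact: e_irr. Qed.

Let r_total u v : u != v -> r u v || r v u.
Proof. by rewrite orbC; apply: e_total. Qed.

Definition twin_dominates (S : {set T}) := forall v, v \notin S ->
  (exists2 u, u \in S & e v u) /\ (exists2 u, u \in S & e u v).

Lemma cards_star x (P Q : {set T}) : #|x |: (P :|: Q)| <= (#|P| + #|Q|).+1.
Proof.
apply: leq_trans (leq_card_setU _ _) _; rewrite cards1 add1n ltnS.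
exact: leq_card_setU.
Qed.

(** Every other vertex has an arc to or from [x], so only the opposite direction remains to be
    provided. *)
Lemma twin_dominates_star x (P Q : {set T}) :
    (forall v, e v x -> v \notin P -> exists2 u, u \in x |: (P :|: Q) & e u v) ->
    (forall v, e x v -> v \notin Q -> exists2 u, u \in x |: (P :|: Q) & e v u) ->
  twin_dominates (x |: (P :|: Q)).
Proof.
move=> domP absQ v; rewrite !inE !negb_or => /and3P[vx vP vQ].
have xS : x \in x |: (P :|: Q) by rewrite setU11.
case/orP: (e_total vx) => [evx|exv]; split; try by exists x.
  exact: domP.
exact: absQ.
Qed.

Lemma exists_twin_dominates_star x p q :
    #|[set v | e v x]|.+2 <= 2 ^ p.+1 -> #|[set v | e x v]|.+2 <= 2 ^ q.+1 ->
  exists2 S : {set T}, #|S| <= (p + q).+1 & twin_dominates S.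
Proof.
move=> /(exists_dominating e_irr e_total)[P [_ leP domP]].
move=> /(exists_dominating r_irr r_total)[Q [_ leQ absQ]].
exists (x |: (P :|: Q)).
  by apply: leq_trans (cards_star _ _ _) _; rewrite ltnS leq_add.
apply: twin_dominates_star => v xv.
  case/domP => [|u uP euv]; first by rewrite inE.
  by exists u; rewrite // !inE uP orbT.
case/absQ => [|u uQ euv]; first by rewrite inE.
by exists u; rewrite // !inE uQ !orbT.
Qed.

Let O x := [set v | e x v].
Let I x := [set v | e v x].

Lemma card_out_in x : #|T| = (#|O x| + #|I x|).+1.
Proof.
rewrite -cardsT (cards_beats e_irr (in_setT x)); congr (_ + _).+1.
  by apply: eq_card => y; rewrite !inE.
apply: eq_card => y; rewrite !inE.
have [->|yx] /= := eqVneq; first by rewrite e_irr.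
have [/e_asym/negbTE-> //|nexy] := boolP (e x y).
by have := e_total yx; rewrite (negbTE nexy) orbF => ->.
Qed.

Lemma exists_twin_dominates4_deg3 x : #|O x| = 3 -> #|I x| = 4 ->
  (forall y, #|O y| <= 4) -> exists2 S : {set T}, #|S| <= 4 & twin_dominates S.
Proof.
move=> O3 I4 Ole4.
have [/exists_inP[o Oo /forall_inP sink]|] :=
    boolP [exists o in O x, forall v in O x, (v != o) ==> e v o].
  have [|P [_ leP domP]] := @exists_dominating _ _ e_irr e_total 2 (I x).
    by rewrite I4.
  exists (x |: (P :|: [set o])).
    by apply: leq_trans (cards_star _ _ _) _; rewrite cards1 addn1.
  apply: twin_dominates_star => v xv.
    case/domP => [|u uP euv]; first by rewrite inE.
    by exists u; rewrite // !inE uP orbT.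
  rewrite inE => vo; exists o; first by rewrite !inE eqxx !orbT.
  by apply: (implyP (sink v _)); rewrite ?inE.
rewrite negb_exists_in => /forall_inP nosink.
have [|a Ia ahalf] := @exists_beats_half _ _ e_total (I x).
  by rewrite -card_gt0 I4.
have := cards_beats e_irr Ia.
set B := [set y in I x | (y != a) && _]; move=> cardI.
have leB : #|B| <= 1 by move: cardI ahalf; rewrite I4; lia.
(* [B] is what [a] leaves undominated in [I x], at most one vertex [d]. *)
have [o Oo oB] : exists2 o, o \in O x & forall d, d \in B -> e o d.
  have [B0|[d Bd]] := set_0Vmem B.
    have /card_gt0P[o Oo] : 0 < #|O x| by rewrite O3.
    by exists o => // d; rewrite B0 inE.
  have Bd1 d' : d' \in B -> d' = d.
    by move=> Bd'; apply: (card_le1_eqP leB).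
  suff /exists_inP[o Oo od] : [exists o in O x, e o d].
    by exists o => // d' /Bd1->.
  apply: contraT; rewrite negb_exists_in => /forall_inP dO.
  move: Bd; rewrite !inE => /and3P[edx da nead].
  have eda : e d a by have := e_total da; rewrite (negbTE nead) orbF.
  (* These five out-neighbours of [d] contradict [Ole4]. *)
  have : x |: (a |: O x) \subset O d.
    apply/subsetP => v; rewrite [v \in O d]inE => /setU1P[->|/setU1P[->|Ov]] //.
    have vd : v != d.
      by apply: contraTneq Ov => ->; rewrite inE; apply: e_asym.
    by have := e_total vd; rewrite (negbTE (dO _ Ov)).
  move/subset_leq_card; rewrite !cardsU1 O3 !inE e_irr orbF.
  have xa : x != a by apply: contraTneq Ia => ->; rewrite inE e_irr.
  have := Ole4 d; move: Ia; rewrite inE => /e_asym->; rewrite xa /=; lia.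
have [o' Oo' /andP[o'o no'o]] : exists2 o', o' \in O x & (o' != o) && ~~ e o' o.
  by have := nosink o Oo; rewrite negb_forall_in => /exists_inP[o' Oo'];
     rewrite negb_imply; exists o'.
have oo' : e o o' by have := e_total o'o; rewrite (negbTE no'o).
exists (x |: ([set a] :|: [set o; o'])).
  apply: leq_trans (cards_star _ _ _) _.
  by rewrite cards1 cards2; case: (o != o').
apply: twin_dominates_star => v xv.
  rewrite inE => va; have [eav|neav] := boolP (e a v).
    by exists a; rewrite // !inE eqxx orbT.
  by exists o; [rewrite !inE eqxx !orbT | apply: oB; rewrite !inE xv va].
rewrite !inE negb_or => /andP[vo vo'].
have [evo|nevo] := boolP (e v o); first by exists o; rewrite // !inE eqxx !orbT.
have [evo'|nevo'] := boolP (e v o').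
  by exists o'; rewrite // !inE eqxx !orbT.
(* Beaten by both [o] and [o'], [v] would be a sink of [O x], which consists of these three
   vertices. *)
have Ov : v \in O x by rewrite inE.
have /eqP OE : [set v; o; o'] == O x.
  rewrite eqEcard O3 !subUset !sub1set Ov Oo Oo' /= -setUA cardsU1 cards2.
  by rewrite !inE negb_or vo vo' eq_sym o'o.
case/negP: (nosink v Ov); apply/forall_inP => w; rewrite -OE !inE -orbA.
case/or3P => /eqP->; first by rewrite eqxx.
  by have := e_total vo; rewrite (negbTE nevo) /= => ->; rewrite implybT.
by have := e_total vo'; rewrite (negbTE nevo') /= => ->; rewrite implybT.
Qed.

Lemma exists_twin_dominates4 : #|T| = 8 ->
  exists2 S : {set T}, #|S| <= 4 & twin_dominates S.
Proof.
move=> T8.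
have [/existsP[x]|] := boolP [exists x, (#|O x| < 3) || (4 < #|O x|)].
  have := card_out_in x; rewrite T8 => - [OI] degx.
  (* Sets of size 0, 1, 2, 3 handle up to 0, 2, 6, 14 vertices; each case splits 3 as [p + q]. *)
  have [O0|O1] := leqP #|O x| 0.
    by apply: (@exists_twin_dominates_star x 3 0);
       rewrite -/(O x) -/(I x) ?expnS; lia.
  have [O2|O3] := leqP #|O x| 2.
    by apply: (@exists_twin_dominates_star x 2 1);
       rewrite -/(O x) -/(I x) ?expnS; lia.
  have [O6|O7] := leqP #|O x| 6.
    by apply: (@exists_twin_dominates_star x 1 2);
       rewrite -/(O x) -/(I x) ?expnS; lia.
  by apply: (@exists_twin_dominates_star x 0 3);
       rewrite -/(O x) -/(I x) ?expnS; lia.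
rewrite negb_exists => /forallP deg.
(* With arcs reversed, this gives [x] in-degree at least 4; since its out-degree is at least 3, the
   degrees are 4 and 3. *)
have [|x _] := @exists_beats_half _ _ r_total [set: T].
  by rewrite -card_gt0 cardsT T8.
have -> : [set y in [set: T] | r x y] = I x by apply/setP => y; rewrite !inE.
rewrite cardsT T8 => I4.
have := card_out_in x; have := deg x; rewrite T8 => degx OI.
apply: (@exists_twin_dominates4_deg3 x); [lia|lia|].
by move=> y; have := deg y; lia.
Qed.

End TwinDominatingTournament.

(** * The extremal tournament and the two bounds *)

(* Vertices 0, ..., 6 stand for Z/7, and vertex 7 is the source. *)
Definition qr_arc (u v : nat) : bool :=
  (u != v) && (v != 7) && ((u == 7) || ((v + 7 - u) %% 7 \in [:: 1; 2; 4])).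

Definition qr_tournament : digraph 'I_8 :=
  [set p : 'I_8 * 'I_8 | qr_arc p.1 p.2].

(** Reduces claims about ordinals to checks on [nat] that evaluation settles. *)
Lemma all_iota_ord n (P : pred nat) : all P (iota 0 n) -> forall i : 'I_n, P i.
Proof. by move=> /allP Pn i; apply: Pn; rewrite mem_iota ltn_ord. Qed.

Lemma qr_tournament_orientation :
  orientation (complete_graph 8) qr_tournament.
Proof.
apply/forallP => u; apply/forallP => v; rewrite !inE /=.
have : all (fun i => all (fun j =>
    if i != j then qr_arc i j (+) qr_arc j i else ~~ qr_arc i j)
  (iota 0 8)) (iota 0 8) by [].
by move=> /all_iota_ord/(_ u)/all_iota_ord/(_ v).
Qed.

(* Allowing repetitions covers the sets of fewer than three vertices. *)
Lemma qr_triple (a b c : 'I_8) : exists2 v : 'I_8, v \notin [:: a; b; c] &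
  {in [:: a; b; c], forall u : 'I_8, ~~ qr_arc v u} \/
  {in [:: a; b; c], forall u : 'I_8, ~~ qr_arc u v}.
Proof.
have : all (fun i => all (fun j => all (fun k => has (fun l =>
    (l \notin [:: i; j; k]) && (all (fun u => ~~ qr_arc l u) [:: i; j; k] ||
      all (fun u => ~~ qr_arc u l) [:: i; j; k])) (iota 0 8))
  (iota 0 8)) (iota 0 8)) (iota 0 8) by [].
move=> /all_iota_ord/(_ a)/all_iota_ord/(_ b)/all_iota_ord/(_ c).
move=> /hasP[l]; rewrite mem_iota => /= l8 /andP[labc arcs].
exists (Ordinal l8); first by move: labc; rewrite !inE.
case/orP: arcs => arcs; [left|right] => u.
  by rewrite !inE; case/and4P: arcs => ? ? ? _ /or3P[] /eqP->.
by rewrite !inE; case/and4P: arcs => ? ? ? _ /or3P[] /eqP->.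
Qed.

Lemma qr_twin_dominating_card (S : {set 'I_8}) :
  twin_dominating qr_tournament S -> 3 < #|S|.
Proof.
move=> /forallP tdS; rewrite ltnNge; apply/negP => S3.
(* If [S] has fewer than three elements, the default [ord0] pads the triple; only the inclusion of
   [S] in it matters. *)
pose x i := nth ord0 (enum S) i.
have Sx u : u \in S -> u \in [:: x 0; x 1; x 2].
  rewrite -mem_enum => /[dup]/(nth_index ord0) {2}<-.
  rewrite -index_mem -cardE => /leq_trans/(_ S3).
  by case: index => [|[|[|]]] //; rewrite !inE eqxx ?orbT.
have [v vx arcs] := qr_triple (x 0) (x 1) (x 2).
have := tdS v; have -> /= : v \notin S by apply: contra vx; apply: Sx.
case/andP => /exists_inP[u Su uv] /exists_inP[w Sw wv].
rewrite !inE /= in uv wv.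
case: arcs => arcs; first by have := arcs u (Sx u Su); rewrite uv.
by have := arcs w (Sx w Sw); rewrite wv.
Qed.

Lemma tournament8_twin_domination_number (D : digraph 'I_8) :
  orientation (complete_graph 8) D -> twin_domination_number D <= 4.
Proof.
move=> /forallP orD; pose e : rel 'I_8 := fun u v => (u, v) \in D.
have e_xor u v : u != v -> e u v (+) e v u.
  by move=> uv; have /forallP/(_ v) := orD u; rewrite /= uv.
have e_irr u : ~~ e u u.
  by have /forallP/(_ u) := orD u; rewrite /= eqxx.
have [u v euv|u v /e_xor||S S4 tdS] := @exists_twin_dominates4 _ e.
- have /e_xor : u != v by apply: contraTneq euv => ->; apply: e_irr.
  by rewrite euv.
- by case: (e u v).
- by rewrite card_ord.
rewrite /twin_domination_number; case: arg_minnP => [|S' _ minS'].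
  exact: twin_dominating_setT.
apply: leq_trans S4; apply: minS'; apply/forallP => v; apply/implyP => /tdS.
by move=> [[u uS vu] [w wS wv]]; apply/andP; split; apply/exists_inP;
   [exists u | exists w].
Qed.

Theorem theorem2p5 : upper_twin_domination (complete_graph 8) = 4.
Proof.
apply/eqP; rewrite eqn_leq; apply/andP; split.
  by apply/bigmax_leqP => D; apply: tournament8_twin_domination_number.
apply: leq_trans (leq_bigmax_cond _ qr_tournament_orientation).
rewrite /twin_domination_number; case: arg_minnP => [|S tdS _].
  exact: twin_dominating_setT.
exact: qr_twin_dominating_card.
Qed.
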